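(* Let $h\in\mathbb{R}\setminus\{0\}$ and $\theta\in[0,2\pi)$. For any $f\in\mathcal{LP}$, all the zeros of $\Delta_{\theta,h}(f)$ are real and simple.
   Context: The operator $\Delta_{\theta,h}$ is defined on entire functions by $$\Delta_{\theta,h}(f)(x)=\frac{e^{i\theta}f(x+ih)-e^{-i\theta}f(x-ih)}{2i}.$$ The Laguerre-Pólya class $\mathcal{LP}$ consists of the real entire functions of the form $$f(z)=cz^ne^{-az^2+bz}\prod_{k=1}^\infty\left(1-\frac{z}{x_k}\right)e^{z/x_k},$$ where $c,b,x_k\in\mathbb{R}$, $x_k\neq0$, $a\geq0$, $n$ is a non-negative integer and $\sum_{k=1}^\infty x_k^{-2}<\infty$; the product can be finite or empty (in the latter case it equals $1$).
   Formalization: The formal theorem additionally assumes that Δ_{θ,h}(f) is not identically zero; without this the claim fails, e.g. for f = 1 and θ = 0, where Δ_{θ,h}(f) vanishes everywhere. *)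

(* Defs.v *)
From Stdlib Require Import Reals List.
From Coquelicot Require Import Coquelicot.
Open Scope C_scope.

Definition Cexp (z : C) : C :=
  RtoC (exp (Re z)) * (cos (Im z), sin (Im z)).

Definition entire (f : C -> C) : Prop :=
  forall z : C, ex_derive (K := C_AbsRing) (V := C_NormedModule) f z.

Definition real_entire (f : C -> C) : Prop :=
  entire f /\ forall x : R, Im (f (RtoC x)) = 0%R.

Definition Cprod (l : list C) : C := fold_right Cmult (RtoC 1) l.

Definition weierstrass_factor (x : R) (z : C) : C :=
  (1 - z / RtoC x) * Cexp (z / RtoC x).

(* [P] is the product of [weierstrass_factor x_k] over a finite (possibly
   empty) family of nonzero reals, or over an infinite sequence of nonzero
   reals with [sum 1 / x_k ^ 2] convergent; in the second case [P z] is the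
   limit of the partial products. *)
Definition LP_product (P : C -> C) : Prop :=
  (exists xs : list R,
     (forall x : R, In x xs -> x <> 0%R) /\
     forall z : C, P z = Cprod (map (fun x => weierstrass_factor x z) xs))
  \/
  (exists x : nat -> R,
     (forall k : nat, x k <> 0%R) /\
     ex_series (fun k => (/ (x k ^ 2))%R) /\
     forall z : C,
       filterlim
         (fun N => Cprod (map (fun k => weierstrass_factor (x k) z) (seq 0 N)))
         eventually (locally (P z))).

Definition LaguerrePolya (f : C -> C) : Prop :=
  real_entire f /\
  exists (c a b : R) (n : nat) (P : C -> C),
    (0 <= a)%R /\ LP_product P /\
    forall z : C,
      f z = RtoC c * z ^ n * Cexp (- RtoC a * z ^ 2 + RtoC b * z) * P z.

Definition Delta_op (theta h : R) (f : C -> C) (x : C) : C :=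
  (Cexp (Ci * RtoC theta) * f (x + Ci * RtoC h)
   - Cexp (- (Ci * RtoC theta)) * f (x - Ci * RtoC h)) / (2 * Ci).

Definition simple_zero (g : C -> C) (z : C) : Prop :=
  g z = 0 /\
  exists l : C, is_derive (K := C_AbsRing) (V := C_NormedModule) g z l /\ l <> 0.

(* Main.v *)
Require Import Defs.
From Stdlib Require Import Reals Lra List.
From Coquelicot Require Import Coquelicot.
Open Scope C_scope.

(* For fixed [x], each factor of [|f (x + iy)|^2] is a nondecreasing function of [|y|], and
   unless [f] is a real exponential one of them stays nondecreasing after division by some
   [al + be * y^2] with [al >= 0] and [be > 0]; so then does [|f (x + iy)|^2] itself, by passing to the
   limit in the product. At a zero [z] of [Delta f], [|f (z + ih)| = |f (z - ih)|], which forces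
   [z] real, since [f] has only real zeros. At a double real zero [x], the number
   [Im (f' conj f)] would coincide at [x + ih] and [x - ih]; but it is, up to a negative factor,
   the derivative of [|f (x + iy)|^2] in [y], which has opposite signs at [h] and [-h].
   Comparing with the quadratic avoids differentiating the infinite product. *)

(** * Squared modulus and the complex exponential *)

(** The square keeps the modulus polynomial in the coordinates, hence multiplicative by [ring] and
    differentiable also at zeros. *)
Definition sqmod (z : C) : R := (Re z ^ 2 + Im z ^ 2)%R.

Lemma sqmod_ge0 (z : C) : (0 <= sqmod z)%R.
Proof. unfold sqmod; nra. Qed.

Lemma sqmod_mult (z w : C) : sqmod (z * w) = (sqmod z * sqmod w)%R.
Proof. destruct z, w; unfold sqmod; simpl; ring. Qed.

Lemma sqmod_RtoC (c : R) : sqmod (RtoC c) = (c ^ 2)%R.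
Proof. unfold sqmod; simpl; ring. Qed.

Lemma sqmod_pow (z : C) (n : nat) : sqmod (z ^ n) = (sqmod z ^ n)%R.
Proof.
  induction n as [|n IH].
  - unfold sqmod; simpl; ring.
  - now rewrite Cpow_S, sqmod_mult, IH.
Qed.

Lemma sqmod_Cexp (z : C) : sqmod (Cexp z) = exp (2 * Re z).
Proof.
  unfold Cexp; rewrite sqmod_mult, sqmod_RtoC.
  replace (2 * Re z)%R with (Re z + Re z)%R by ring.
  rewrite exp_plus; unfold sqmod; simpl.
  pose proof (sin2_cos2 (snd z)) as H; unfold Rsqr in H; unfold Re, Im.
  replace (cos (snd z) * (cos (snd z) * 1) + sin (snd z) * (sin (snd z) * 1))%R
    with 1%R by lra.
  ring.
Qed.

Lemma sqmod_eq0 (z : C) : sqmod z = 0%R <-> z = 0.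
Proof.
  destruct z as [x y]; unfold sqmod; simpl; split; intros H.
  - unfold RtoC; f_equal; nra.
  - injection H as -> ->; ring.
Qed.

Lemma sqmod_gt0 (z : C) : z <> 0 -> (0 < sqmod z)%R.
Proof.
  intros Hz; destruct (sqmod_ge0 z) as [|E]; auto.
  now contradict Hz; apply sqmod_eq0.
Qed.

Lemma Cexp_plus (z w : C) : Cexp (z + w) = Cexp z * Cexp w.
Proof.
  destruct z as [a b], w as [c d]; unfold Cexp; simpl.
  rewrite exp_plus, cos_plus, sin_plus.
  unfold Cmult, RtoC; simpl; f_equal; ring.
Qed.

Lemma sqmod_weierstrass_factor (r x y : R) : r <> 0%R ->
  sqmod (weierstrass_factor r (x, y)) =
  (((1 - x * / r) ^ 2 + (y * / r) ^ 2) * exp (2 * (x * / r)))%R.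
Proof.
  intros Hr; unfold weierstrass_factor; rewrite sqmod_mult, sqmod_Cexp.
  replace ((x, y) / RtoC r) with ((x * / r)%R, (y * / r)%R).
  - unfold sqmod; simpl; f_equal; ring.
  - unfold Cdiv, Cmult, Cinv, RtoC; simpl; f_equal; field; auto.
Qed.

(** * Growth relative to a quadratic *)

(* Says that [phi y / (al + be * y ^ 2)] is nondecreasing in [|y|], without dividing. *)
Definition growth (al be : R) (phi : R -> R) : Prop :=
  (forall y : R, 0 <= phi y)%R /\
  (forall y1 y2 : R, y1 ^ 2 <= y2 ^ 2 ->
     phi y1 * (al + be * y2 ^ 2) <= phi y2 * (al + be * y1 ^ 2))%R.

Open Scope R_scope.

Lemma growth_ext (al be : R) (phi chi : R -> R) :
  (forall y, phi y = chi y) -> growth al be phi -> growth al be chi.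
Proof.
  intros E [H0 H]; split; intros; rewrite <- !E; auto.
Qed.

(** [growth 1 0] is plain monotonicity in [|y|], so a single factor beating the quadratic is enough
    for a whole product. *)
Lemma growth_mult (al be : R) (phi chi : R -> R) : 0 <= al -> 0 <= be ->
  growth al be phi -> growth 1 0 chi -> growth al be (fun y => phi y * chi y).
Proof.
  intros Hal Hbe [P0 P] [Q0 Q]; split.
  - intros y; apply Rmult_le_pos; auto.
  - intros y1 y2 Hy; specialize (P _ _ Hy); specialize (Q _ _ Hy).
    assert (chi y1 <= chi y2) by lra.
    pose proof (P0 y1); pose proof (P0 y2); pose proof (Q0 y1).
    replace (phi y1 * chi y1 * (al + be * y2 ^ 2))
      with (phi y1 * (al + be * y2 ^ 2) * chi y1) by ring.
    replace (phi y2 * chi y2 * (al + be * y1 ^ 2))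
      with (phi y2 * (al + be * y1 ^ 2) * chi y2) by ring.
    apply Rmult_le_compat; auto.
    apply Rmult_le_pos; auto; nra.
Qed.

(** The quadratic is itself nondecreasing in [|y|]. Since [al] may be zero, the quadratic can vanish
    at the origin, and [y2 = 0] is treated apart. *)
Lemma growth_weaken (al be : R) (phi : R -> R) : 0 <= al -> 0 < be ->
  growth al be phi -> growth 1 0 phi.
Proof.
  intros Hal Hbe [P0 P]; split; auto; intros y1 y2 Hy.
  pose proof (P0 y1); pose proof (P0 y2); specialize (P _ _ Hy).
  destruct (Rle_lt_dec (phi y1) (phi y2)) as [?|Hlt]; [lra|exfalso].
  destruct (Req_dec y2 0) as [->|Hz].
  - assert (y1 = 0) as -> by nra; lra.
  - assert (Hy2 : 0 < y2 ^ 2) by nra.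
    assert (0 < be * y2 ^ 2) by now apply Rmult_lt_0_compat.
    assert (be * y1 ^ 2 <= be * y2 ^ 2) by (apply Rmult_le_compat_l; lra).
    nra.
Qed.

Lemma growth_const (c : R) : 0 <= c -> growth 1 0 (fun _ => c).
Proof. intros; split; intros; lra. Qed.

Lemma growth_pow (phi : R -> R) (n : nat) :
  growth 1 0 phi -> growth 1 0 (fun y => phi y ^ n).
Proof.
  intros H; induction n as [|n IH]; simpl.
  - apply growth_const; lra.
  - apply growth_mult; auto; lra.
Qed.

Lemma growth_quadratic (al be c : R) : 0 <= al -> 0 <= be -> 0 <= c ->
  growth al be (fun y => (al + be * y ^ 2) * c).
Proof.
  intros; split; intros.
  - apply Rmult_le_pos; nra.
  - apply Req_le; ring.
Qed.

(* [exp s / (1 + s)] is nondecreasing for [s >= 0]. *)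
Lemma growth_gauss (be c : R) : 0 <= be -> 0 <= c ->
  growth 1 be (fun y => exp (be * y ^ 2) * c).
Proof.
  intros Hbe Hc; split.
  - intros y; apply Rmult_le_pos; auto; left; apply exp_pos.
  - intros y1 y2 Hy.
    replace (be * y2 ^ 2) with (be * y1 ^ 2 + be * (y2 ^ 2 - y1 ^ 2)) by ring.
    rewrite exp_plus.
    assert (Hd : 0 <= be * (y2 ^ 2 - y1 ^ 2)) by (apply Rmult_le_pos; lra).
    assert (Hs : 0 <= be * y1 ^ 2) by (apply Rmult_le_pos; nra).
    (* It remains to see that [1 + s + d <= (1 + d) * (1 + s) <= exp d * (1 + s)]. *)
    pose proof (exp_ineq1_le (be * (y2 ^ 2 - y1 ^ 2))) as He.
    pose proof (exp_pos (be * y1 ^ 2)) as Hp.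
    set (d := be * (y2 ^ 2 - y1 ^ 2)) in *; set (s := be * y1 ^ 2) in *.
    replace (exp s * exp d * c * (1 + s)) with (exp s * c * (exp d * (1 + s))) by ring.
    apply Rmult_le_compat_l; [apply Rmult_le_pos; lra|nra].
Qed.

(** Both conditions are non-strict and free of division, so they are closed under pointwise limits
    when [al] and [be] stay fixed. *)
Lemma growth_lim (al be : R) (phi : nat -> R -> R) (chi : R -> R) :
  (forall n, growth al be (phi n)) ->
  (forall y, is_lim_seq (fun n => phi n y) (chi y)) -> growth al be chi.
Proof.
  intros H L; split.
  - intros y; apply (is_lim_seq_le (fun _ => 0) (fun n => phi n y) 0 (chi y)).
    + intros n; apply H.
    + apply is_lim_seq_const.
    + apply L.
  - intros y1 y2 Hy.
    apply (is_lim_seq_le (fun n => phi n y1 * (al + be * y2 ^ 2))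
             (fun n => phi n y2 * (al + be * y1 ^ 2))
             (chi y1 * (al + be * y2 ^ 2)) (chi y2 * (al + be * y1 ^ 2))).
    + intros n; now apply H.
    + apply is_lim_seq_mult'; [apply L|apply is_lim_seq_const].
    + apply is_lim_seq_mult'; [apply L|apply is_lim_seq_const].
Qed.

(** * Strict consequences of growth: equal values and derivatives *)

(** A common nonzero value could be cancelled, leaving [be * y2 ^ 2 <= be * y1 ^ 2]. *)
Lemma growth_unbalanced (al be : R) (phi : R -> R) (y1 y2 : R) : 0 < be ->
  growth al be phi -> y1 ^ 2 < y2 ^ 2 -> phi y1 = phi y2 -> phi y2 = 0.
Proof.
  intros Hbe [P0 P] Hy E.
  specialize (P y1 y2 (Rlt_le _ _ Hy)); pose proof (P0 y2).
  rewrite E in P.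
  assert (0 < be * (y2 ^ 2 - y1 ^ 2)) by (apply Rmult_lt_0_compat; lra).
  nra.
Qed.

(** Moving from [y] away from the origin, [D] starts at 0 and stays nonnegative, so its outward
    derivative is nonnegative. *)
Lemma derive_sign (D : R -> R) (y d : R) : y <> 0 -> is_derive D y d ->
  D y = 0 -> (forall t, y ^ 2 <= t ^ 2 -> 0 <= D t) -> 0 <= d * y.
Proof.
  intros Hy HD H0 Hpos.
  destruct (Rle_lt_dec 0 (d * y)) as [?|Hneg]; auto; exfalso.
  assert (Hd : 0 < Rabs d) by (apply Rabs_pos_lt; intros ->; lra).
  apply is_derive_Reals in HD.
  destruct (HD (Rabs d) Hd) as [delta Hdelta].
  assert (Hay : 0 < Rabs y) by now apply Rabs_pos_lt.
  pose proof (cond_pos delta) as Hdp.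
  (* The increment [s * y] points away from the origin and has length [delta / 2]. *)
  set (s := delta / (2 * Rabs y)).
  assert (Hs : 0 < s) by (apply Rdiv_lt_0_compat; lra).
  assert (Hk : Rabs (s * y) < delta).
  { rewrite Rabs_mult, (Rabs_right s) by lra.
    unfold s; replace (delta / (2 * Rabs y) * Rabs y) with (delta / 2)
      by (field; lra); lra. }
  assert (Hsy : s * y <> 0) by (apply Rmult_integral_contrapositive_currified; lra).
  specialize (Hdelta (s * y) Hsy Hk).
  rewrite H0, Rminus_0_r in Hdelta.
  assert (HD0 : 0 <= D (y + s * y)) by (apply Hpos; nra).
  (* The difference quotient times [y] is nonnegative while [d * y < 0], so quotient and [d] differ
     by at least [Rabs d]. *)
  assert (Hq : 0 <= D (y + s * y) / (s * y) * y).
  { replace (D (y + s * y) / (s * y) * y) with (D (y + s * y) / s) by (field; lra).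
    apply Rdiv_le_0_compat; lra. }
  set (q := D (y + s * y) / (s * y)) in *.
  unfold Rabs in Hdelta; revert Hdelta.
  destruct (Rcase_abs (q - d)), (Rcase_abs d); intros; nra.
Qed.

(** The growth inequality between [y] and [t] is an equality at [t = y]; differentiating there gives
    [d * y * (al + be * y ^ 2) >= 2 * be * y ^ 2 * phi y > 0]. *)
Lemma growth_derive (al be : R) (phi : R -> R) (y d : R) : 0 <= al -> 0 < be ->
  growth al be phi -> y <> 0 -> 0 < phi y -> is_derive phi y d -> 0 < d * y.
Proof.
  intros Hal Hbe [P0 P] Hy Hphi Hd.
  assert (HD : is_derive (fun t => phi t * (al + be * y ^ 2) - phi y * (al + be * t ^ 2)) y
                 (d * (al + be * y ^ 2) - phi y * (2 * be * y))).
  { auto_derive; [now exists d|].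
    replace (Derive _ y) with d by (symmetry; now apply is_derive_unique); ring. }
  apply derive_sign in HD; auto; [|ring|].
  - assert (0 < be * y ^ 2) by (apply Rmult_lt_0_compat; [|apply pow2_gt_0]; auto).
    assert (0 < phi y * (be * y ^ 2)) by (apply Rmult_lt_0_compat; lra).
    destruct (Rlt_le_dec 0 (d * y)) as [|Hle]; auto; exfalso; nra.
  - intros t Ht; specialize (P _ _ Ht); lra.
Qed.

(** * Lower bound for one Weierstrass factor *)

Lemma exp_le_compat (x y : R) : x <= y -> exp x <= exp y.
Proof.
  intros [H| ->]; [left; now apply exp_increasing|apply Rle_refl].
Qed.

(* Uniformity in the inverse zero [t] makes the bound summable over the zeros. *)
Lemma factor_lower_bound (x y t : R) : y <> 0 ->
  exp (- (5 * (x ^ 2 + y ^ 2) ^ 2 / y ^ 2) * t ^ 2)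
  <= ((1 - x * t) ^ 2 + (y * t) ^ 2) * exp (2 * (x * t)).
Proof.
  intros Hy.
  set (s := x * t); set (u := (1 - s) ^ 2 + (y * t) ^ 2).
  assert (Hy2 : 0 < y ^ 2) by nra.
  set (m := x ^ 2 + y ^ 2).
  assert (Hm : y ^ 2 <= m) by (unfold m; nra).
  (* Completing the square: as a function of [t], [u] has minimum [y ^ 2 / m], attained at
     [t = x / m]. *)
  assert (Hmu : y ^ 2 <= u * m).
  { assert (u * m - y ^ 2 = (m * t - x) ^ 2) by (unfold u, m, s; ring).
    pose proof (pow2_ge_0 (m * t - x)); lra. }
  assert (Hm0 : 0 < m) by lra.
  assert (Hu : 0 < u) by (apply Rmult_lt_reg_r with m; lra).
  (* This is [log u >= 1 - 1 / u] in exponential form. *)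
  assert (Hlog : exp (1 - / u) <= u).
  { pose proof (exp_ineq1_le (/ u - 1)) as H.
    replace (1 - / u) with (- (/ u - 1)) by ring; rewrite exp_Ropp.
    rewrite <- (Rinv_inv u) at 2.
    apply Rinv_le_contravar; [now apply Rinv_0_lt_compat|lra]. }
  apply Rle_trans with (exp (1 - / u) * exp (2 * s)).
  2: { apply Rmult_le_compat_r; auto; left; apply exp_pos. }
  rewrite <- exp_plus; apply exp_le_compat.
  replace (1 - / u + 2 * s) with ((u - 1 + 2 * s * u) / u) by (field; lra).
  apply (proj1 (Rle_div_r _ _ u Hu)).
  set (q := (y * t) ^ 2).
  assert (Hq : 0 <= q) by (unfold q; nra).
  (* The terms linear in [t] cancel, thanks to the exponential convergence factor; only quadratic
     and cubic ones remain. *)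
  assert (Hnum : u - 1 + 2 * s * u = q * (1 + 2 * s) + s ^ 2 * (2 * s - 3)) by (unfold u, q; ring).
  (* Used for [s >= 0], where the cubic terms help and [u] can be removed through [Hmu]. *)
  assert (HC : - (5 * m ^ 2 / y ^ 2) * t ^ 2 * u <= - (5 * m * t ^ 2)).
  { replace (- (5 * m ^ 2 / y ^ 2) * t ^ 2 * u)
      with (- (5 * m * t ^ 2) * (u * m / y ^ 2)) by (field; lra).
    assert (1 <= u * m / y ^ 2) by (apply Rle_div_r; lra).
    assert (0 <= 5 * m * t ^ 2) by (pose proof (pow2_ge_0 t); nra).
    nra. }
  assert (Hmt : m * t ^ 2 = s ^ 2 + q) by (unfold m, s, q; ring).
  destruct (Rle_lt_dec 0 s) as [Hs|Hs].
  - eapply Rle_trans; [apply HC|].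
    rewrite Hnum; nra.
  (* For [s < 0] the cubic part [2 * s * (q + s ^ 2)] is nonpositive; the factor [u >= 1 - 2 * s] is
     kept to absorb it. *)
  - assert (HC2 : - (5 * m ^ 2 / y ^ 2) * t ^ 2 * u <= - (5 * m * t ^ 2) * u).
    { apply Rmult_le_compat_r; [lra|].
      replace (- (5 * m ^ 2 / y ^ 2) * t ^ 2)
        with (- (5 * m * t ^ 2) * (m / y ^ 2)) by (field; lra).
      assert (1 <= m / y ^ 2) by (apply Rle_div_r; lra).
      assert (0 <= 5 * m * t ^ 2) by (pose proof (pow2_ge_0 t); nra).
      nra. }
    eapply Rle_trans; [apply HC2|].
    assert (Hus : 1 - 2 * s <= u) by (unfold u; nra).
    replace (- (5 * m * t ^ 2) * u) with (- 5 * (s ^ 2 + q) * u) by (rewrite <- Hmt; ring).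
    rewrite Hnum.
    assert (0 <= s ^ 2) by nra.
    nra.
Qed.

(** * Growth and lower bounds for finite products *)

Lemma growth_weierstrass_factor (r x : R) : r <> 0 ->
  growth ((1 - x * / r) ^ 2) ((/ r) ^ 2) (fun y => sqmod (weierstrass_factor r (x, y))).
Proof.
  intros Hr.
  eapply growth_ext; [|apply (growth_quadratic _ _ (exp (2 * (x * / r))))].
  - intros y; rewrite sqmod_weierstrass_factor by auto; simpl; ring.
  - apply pow2_ge_0.
  - apply pow2_ge_0.
  - left; apply exp_pos.
Qed.

Definition wprod (xs : list R) (z : C) : C :=
  Cprod (map (fun r => weierstrass_factor r z) xs).

Lemma inv_sq_gt0 (r : R) : r <> 0 -> 0 < (/ r) ^ 2.
Proof. intros Hr; apply pow2_gt_0; now apply Rinv_neq_0_compat. Qed.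

Lemma growth_wprod (xs : list R) (x : R) : (forall r, In r xs -> r <> 0) ->
  growth 1 0 (fun y => sqmod (wprod xs (x, y))).
Proof.
  induction xs as [|r xs IH]; intros H.
  - apply (growth_ext _ _ (fun _ => 1)); [|apply growth_const; lra].
    intros y; unfold sqmod; simpl; ring.
  - apply (growth_ext _ _ (fun y => sqmod (weierstrass_factor r (x, y))
                                    * sqmod (wprod xs (x, y)))).
    + intros y; now rewrite <- sqmod_mult.
    + assert (Hr : r <> 0) by (apply H; now left).
      apply growth_mult; try lra.
      * eapply growth_weaken; [| |now apply growth_weierstrass_factor].
        -- apply pow2_ge_0.
        -- now apply inv_sq_gt0.
      * apply IH; intros; apply H; now right.
Qed.

(** The first factor alone supplies the quadratic, which therefore does not change as the product
    gets longer; this is what allows a limit. *)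
Lemma growth_wprod_cons (r : R) (xs : list R) (x : R) :
  (forall r', In r' (r :: xs) -> r' <> 0) ->
  growth ((1 - x * / r) ^ 2) ((/ r) ^ 2) (fun y => sqmod (wprod (r :: xs) (x, y))).
Proof.
  intros H.
  apply (growth_ext _ _ (fun y => sqmod (weierstrass_factor r (x, y))
                                  * sqmod (wprod xs (x, y)))).
  - intros y; now rewrite <- sqmod_mult.
  - assert (Hr : r <> 0) by (apply H; now left).
    apply growth_mult.
    + apply pow2_ge_0.
    + apply pow2_ge_0.
    + now apply growth_weierstrass_factor.
    + apply growth_wprod; intros; apply H; now right.
Qed.

Definition inv_sq_sum (xs : list R) : R := fold_right Rplus 0 (map (fun r => / r ^ 2) xs).

(** The exponents of the single-factor bounds add up to a multiple of the sum of inverse squares. *)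
Lemma wprod_lower_bound (xs : list R) (x y : R) : y <> 0 ->
  (forall r, In r xs -> r <> 0) ->
  exp (- (5 * (x ^ 2 + y ^ 2) ^ 2 / y ^ 2) * inv_sq_sum xs) <= sqmod (wprod xs (x, y)).
Proof.
  intros Hy; induction xs as [|r xs IH]; intros H.
  - unfold inv_sq_sum, wprod, sqmod; simpl; rewrite Rmult_0_r, exp_0; lra.
  - change (wprod (r :: xs) (x, y)) with (Cmult (weierstrass_factor r (x, y)) (wprod xs (x, y))).
    change (inv_sq_sum (r :: xs)) with (/ r ^ 2 + inv_sq_sum xs).
    assert (Hr : r <> 0) by (apply H; now left).
    rewrite sqmod_mult, Rmult_plus_distr_l, exp_plus.
    apply Rmult_le_compat.
    + left; apply exp_pos.
    + left; apply exp_pos.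
    + rewrite sqmod_weierstrass_factor, <- pow_inv by auto.
      now apply factor_lower_bound.
    + apply IH; intros; apply H; now right.
Qed.

(** * Infinite products as limits *)

Lemma wprod_seq (x : nat -> R) (N : nat) (z : C) :
  Cprod (map (fun k => weierstrass_factor (x k) z) (seq 0 N)) = wprod (map x (seq 0 N)) z.
Proof. unfold wprod; now rewrite map_map. Qed.

(** [sum_n] includes the index [N], hence [S N] factors on the left. *)
Lemma inv_sq_sum_seq (x : nat -> R) (N : nat) :
  inv_sq_sum (map x (seq 0 (S N))) = sum_n (fun k => / x k ^ 2) N.
Proof.
  assert (Happ : forall xs ys, inv_sq_sum (xs ++ ys) = inv_sq_sum xs + inv_sq_sum ys).
  { intros xs ys; induction xs as [|r xs IH]; unfold inv_sq_sum in *; simpl in *; lra. }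
  induction N as [|N IH].
  - rewrite sum_O; unfold inv_sq_sum; simpl; ring.
  - rewrite sum_Sn, seq_S, map_app, Happ, IH; unfold inv_sq_sum; simpl.
    unfold plus; simpl; ring.
Qed.

Lemma is_lim_seq_sqmod (u : nat -> C) (l : C) :
  filterlim u eventually (locally l) -> is_lim_seq (fun n => sqmod (u n)) (sqmod l).
Proof.
  intros H.
  assert (H1 : is_lim_seq (fun n => Re (u n)) (Re l)).
  { intros P [eps HP]; apply (H (fun z => P (Re z))).
    exists eps; intros z [Hz _]; now apply HP. }
  assert (H2 : is_lim_seq (fun n => Im (u n)) (Im l)).
  { intros P [eps HP]; apply (H (fun z => P (Im z))).
    exists eps; intros z [_ Hz]; now apply HP. }
  apply (is_lim_seq_ext (fun n => Re (u n) * Re (u n) + Im (u n) * Im (u n))).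
  - intros n; unfold sqmod; ring.
  - replace (sqmod l) with (Re l * Re l + Im l * Im l) by (unfold sqmod; ring).
    apply is_lim_seq_plus'; now apply is_lim_seq_mult'.
Qed.

(** A limit of nonzero products might vanish; convergence of the inverse squares gives a positive
    lower bound common to all partial products. *)
Lemma LP_product_neq0 (P : C -> C) (x y : R) :
  LP_product P -> y <> 0 -> P (x, y) <> 0%C.
Proof.
  intros HP Hy; rewrite <- sqmod_eq0; apply Rgt_not_eq.
  destruct HP as [(xs & Hxs & HP)|(r & Hr & Hs & HP)].
  - rewrite HP; eapply Rlt_le_trans; [apply exp_pos|].
    now apply wprod_lower_bound.
  - set (K := 5 * (x ^ 2 + y ^ 2) ^ 2 / y ^ 2).
    assert (HK : 0 <= K) by (apply Rdiv_le_0_compat; nra).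
    apply Rlt_le_trans with (exp (- K * Series (fun k => / r k ^ 2))); [apply exp_pos|].
    specialize (HP (x, y)); apply is_lim_seq_sqmod, is_lim_seq_incr_1 in HP.
    refine (is_lim_seq_le (fun _ => exp (- K * Series (fun k => / r k ^ 2))) _
             (Finite _) (Finite _) _ (is_lim_seq_const _) HP).
    intros N; rewrite wprod_seq.
    eapply Rle_trans; [|apply wprod_lower_bound; auto].
    + apply exp_le_compat; fold K; rewrite inv_sq_sum_seq.
      assert (Hle : sum_n (fun k => / r k ^ 2) N <= Series (fun k => / r k ^ 2)).
      { apply (is_lim_seq_incr_compare (sum_n (fun k => / r k ^ 2))).
        - apply (Series_correct _ Hs).
        - intros n; rewrite sum_Sn; unfold plus; simpl.
          assert (0 < / (r (S n) * (r (S n) * 1))); [|lra].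
          apply Rinv_0_lt_compat; specialize (Hr (S n)); nra. }
      nra.
    + intros r' Hin; apply in_map_iff in Hin as (k & <- & _); apply Hr.
Qed.

(** Only the empty product lacks a factor to compare with; otherwise the first zero provides [al]
    and [be]. *)
Lemma LP_product_growth (P : C -> C) : LP_product P ->
  (forall z, P z = 1%C) \/
  (forall x, exists al be, 0 <= al /\ 0 < be /\ growth al be (fun y => sqmod (P (x, y)))).
Proof.
  intros [([|r xs] & Hxs & HP)|(r & Hr & Hs & HP)].
  - left; intros z; now rewrite HP.
  - right; intros x; exists ((1 - x * / r) ^ 2), ((/ r) ^ 2); repeat split.
    + apply pow2_ge_0.
    + apply inv_sq_gt0, Hxs; now left.
    + intros y; apply sqmod_ge0.
    + intros y1 y2; rewrite !HP; now apply growth_wprod_cons.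
  - right; intros x; exists ((1 - x * / r 0%nat) ^ 2), ((/ r 0%nat) ^ 2).
    split; [apply pow2_ge_0|split; [now apply inv_sq_gt0|]].
    apply (growth_lim _ _ (fun N y => sqmod (wprod (map r (seq 0 (S N))) (x, y)))).
    + intros N; apply growth_wprod_cons.
      intros r' Hin; change (In r' (map r (seq 0 (S N)))) in Hin.
      apply in_map_iff in Hin as (k & <- & _); apply Hr.
    + intros y; specialize (HP (x, y)); apply is_lim_seq_sqmod, is_lim_seq_incr_1 in HP.
      revert HP; apply is_lim_seq_ext; intros N; now rewrite wprod_seq.
Qed.

(** * Growth dichotomy for the Laguerre-Pólya class *)

(** The quadratic comes from a zero of [P], else from the Gaussian if [a > 0], else from a zero at
    the origin. With none of these [f] is a real exponential, and [c = 0] is counted there too. *)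
Lemma LaguerrePolya_growth (f : C -> C) : LaguerrePolya f ->
  (exists c b : R, forall z, f z = (RtoC c * Cexp (RtoC b * z))%C) \/
  ((forall x y, y <> 0 -> f (x, y) <> 0%C) /\
   forall x, exists al be, 0 <= al /\ 0 < be /\ growth al be (fun y => sqmod (f (x, y)))).
Proof.
  intros [_ (c & a & b & n & P & Ha & HP & Hf)].
  destruct (Req_dec c 0) as [->|Hc].
  { left; exists 0, 0; intros z; rewrite Hf; ring. }
  assert (Hexp : forall x y, sqmod (Cexp (- RtoC a * (x, y) ^ 2 + RtoC b * (x, y)))
                 = exp (2 * a * y ^ 2) * exp (2 * (b * x - a * x ^ 2))).
  { intros x y; rewrite sqmod_Cexp, <- exp_plus; f_equal; simpl; ring. }
  assert (Hsq : forall x y, sqmod (f (x, y)) =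
     c ^ 2 * (x ^ 2 + y ^ 2) ^ n
     * (exp (2 * a * y ^ 2) * exp (2 * (b * x - a * x ^ 2))) * sqmod (P (x, y))).
  { intros x y; rewrite Hf, !sqmod_mult, Hexp, sqmod_RtoC, sqmod_pow; reflexivity. }
  assert (Hc2 : 0 < c ^ 2) by now apply pow2_gt_0.
  assert (Hnz : forall x y, y <> 0 -> f (x, y) <> 0%C).
  { intros x y Hy; rewrite <- sqmod_eq0, Hsq; apply Rgt_not_eq.
    assert (0 < x ^ 2 + y ^ 2)
      by (pose proof (pow2_ge_0 x); pose proof (pow2_gt_0 y Hy); lra).
    apply Rmult_lt_0_compat; [apply Rmult_lt_0_compat|].
    - apply Rmult_lt_0_compat; auto using pow_lt.
    - apply Rmult_lt_0_compat; apply exp_pos.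
    - now apply sqmod_gt0, LP_product_neq0. }
  assert (Hpow : forall x m, growth 1 0 (fun y => (x ^ 2 + y ^ 2) ^ m)).
  { intros x m; apply growth_pow; split; intros; [|lra].
    pose proof (pow2_ge_0 x); pose proof (pow2_ge_0 y); lra. }
  assert (HE : forall x, 0 <= c ^ 2 * exp (2 * (b * x - a * x ^ 2))).
  { intros x; apply Rmult_le_pos; [lra|left; apply exp_pos]. }
  destruct (LP_product_growth P HP) as [HP1|HPg].
  - assert (Hsq1 : forall x y, sqmod (f (x, y)) =
     (x ^ 2 + y ^ 2) ^ n * (exp (2 * a * y ^ 2) * (c ^ 2 * exp (2 * (b * x - a * x ^ 2))))).
    { intros x y; rewrite Hsq, HP1, sqmod_RtoC; ring. }
    destruct (Rle_lt_or_eq_dec 0 a Ha) as [Ha'|<-].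
    + right; split; auto; intros x; exists 1, (2 * a).
      split; [lra|split; [lra|]].
      apply (growth_ext _ _ (fun y =>
        exp (2 * a * y ^ 2) * (c ^ 2 * exp (2 * (b * x - a * x ^ 2)))
        * (x ^ 2 + y ^ 2) ^ n)).
      { intros y; rewrite Hsq1; apply Rmult_comm. }
      apply growth_mult; auto; try lra.
      apply growth_gauss; [lra|apply HE].
    + destruct n as [|n].
      * left; exists c, b; intros z; rewrite Hf, HP1.
        replace (- 0 * z ^ 2 + b * z)%C with (b * z)%C by ring; simpl; ring.
      (* One of the [S n] factors [x ^ 2 + y ^ 2] serves as the quadratic itself. *)
      * right; split; auto; intros x; exists (x ^ 2), 1.
        split; [nra|split; [lra|]].
        apply (growth_ext _ _ (fun y =>
          (x ^ 2 + 1 * y ^ 2) * (c ^ 2 * exp (2 * (b * x - 0 * x ^ 2)))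
          * (x ^ 2 + y ^ 2) ^ n)).
        { intros y; rewrite Hsq1, Rmult_0_r, (Rmult_0_l (y ^ 2)), exp_0; simpl; ring. }
        apply growth_mult; auto; try lra; [apply pow2_ge_0|].
        apply growth_quadratic; [apply pow2_ge_0|lra|apply HE].
  - right; split; auto; intros x.
    destruct (HPg x) as (al & be & Hal & Hbe & HPx); exists al, be.
    split; auto; split; auto.
    apply (growth_ext _ _ (fun y => sqmod (P (x, y)) * ((x ^ 2 + y ^ 2) ^ n
       * (exp (2 * a * y ^ 2) * (c ^ 2 * exp (2 * (b * x - a * x ^ 2))))))).
    { intros y; rewrite Hsq; ring. }
    apply growth_mult; try lra; auto.
    apply growth_mult; try lra; auto.
    destruct (Rle_lt_or_eq_dec 0 a Ha) as [Ha'|Ha'].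
    (* [P] already supplies the quadratic, so the Gaussian need only be nondecreasing. *)
    + apply growth_weaken with 1 (2 * a); try lra.
      apply growth_gauss; [lra|apply HE].
    + apply (growth_ext _ _ (fun _ => c ^ 2 * exp (2 * (b * x - a * x ^ 2)))).
      * intros y; rewrite <- Ha', Rmult_0_r, (Rmult_0_l (y ^ 2)), exp_0; ring.
      * apply growth_const, HE.
Qed.

(** * Derivatives along vertical lines *)

(** By the chain rule, [t => f (x, t)] has derivative [Ci * l], whose coordinates are [- Im l] and
    [Re l]. *)
Lemma is_derive_vertical (f : C -> C) (x y : R) (l : C) :
  is_derive (K := C_AbsRing) (V := C_NormedModule) f (x, y) l ->
  is_derive (fun t => Re (f (x, t))) y (- Im l) /\
  is_derive (fun t => Im (f (x, t))) y (Re l).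
Proof.
  intros [_ H].
  specialize (H (x, y) (fun P HP => HP)).
  (* The complex first-order estimate, restricted to the increments [Ci * (t - y)]. *)
  assert (Hb : forall eps : posreal, locally y (fun t =>
     Cmod (f (x, t) - f (x, y) - RtoC (t - y) * (Ci * l)) <= eps * Rabs (t - y))).
  { intros eps; destruct (H eps) as [d Hd]; exists d; intros t Ht.
    assert (E : minus (G := C_AbsRing) (x, t) (x, y) = (RtoC (t - y) * Ci)%C).
    { unfold minus, plus, opp; simpl; unfold Cplus, Copp, Cmult, RtoC, Ci; simpl.
      f_equal; ring. }
    assert (En : Cmod (RtoC (t - y) * Ci) = Rabs (t - y)).
    { rewrite Cmod_mult, Cmod_R.
      replace (Cmod Ci) with 1; [ring|].
      unfold Cmod, Ci; simpl.
      replace (0 * (0 * 1) + 1 * (1 * 1)) with 1 by ring; now rewrite sqrt_1. }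
    specialize (Hd (x, t)).
    cbv beta in Hd.
    change (norm (K := C_AbsRing) (V := AbsRing_NormedModule C_AbsRing)
       (minus (x, t) (x, y))) with (Cmod (minus (G := C_AbsRing) (x, t) (x, y))) in Hd.
    rewrite E, En in Hd.
    eapply Rle_trans; [|apply Hd]; [apply Req_le; symmetry|].
    - change (Cmod (f (x, t) - f (x, y) - minus (G := C_AbsRing) (x, t) (x, y) * l)
              = Cmod (f (x, t) - f (x, y) - RtoC (t - y) * (Ci * l))).
      rewrite E.
      f_equal; ring.
    - change (Cmod (minus (G := C_AbsRing) (x, t) (x, y)) < d).
      rewrite E, En; exact Ht. }
  split; (split; [apply is_linear_scal_l|]); intros t0 Ht0;
    apply (is_filter_lim_locally_unique (V := R_NormedModule)) in Ht0; subst t0; intros eps;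
    generalize (Hb eps); apply filter_imp; intros t Ht;
    (eapply Rle_trans; [|apply Ht]).
  - eapply Rle_trans; [|apply re_le_Cmod]; apply Req_le.
    change (Rabs (Re (f (x, t)) - Re (f (x, y)) - (t - y) * - Im l)
      = Rabs (Re (f (x, t) - f (x, y) - RtoC (t - y) * (Ci * l)))).
    f_equal; unfold Re, Im; simpl; ring.
  - eapply Rle_trans; [|eapply Rle_trans; [apply Rmax_r|apply Rmax_Cmod]]; apply Req_le.
    change (Rabs (Im (f (x, t)) - Im (f (x, y)) - (t - y) * Re l)
      = Rabs (Im (f (x, t) - f (x, y) - RtoC (t - y) * (Ci * l)))).
    f_equal; unfold Re, Im; simpl; ring.
Qed.

(** The derivative is twice the real part of [Ci * l * Cconj (f (x, y))]. *)
Lemma is_derive_sqmod_vertical (f : C -> C) (x y : R) (l : C) :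
  is_derive (K := C_AbsRing) (V := C_NormedModule) f (x, y) l ->
  is_derive (fun t => sqmod (f (x, t))) y (- 2 * Im (l * Cconj (f (x, y)))).
Proof.
  intros H; apply is_derive_vertical in H as [H1 H2].
  assert (S : forall (u v : R -> R) du dv, is_derive u y du -> is_derive v y dv ->
    is_derive (fun t => u t ^ 2 + v t ^ 2) y (2 * (u y * du + v y * dv))).
  { intros u v du dv Hu Hv; auto_derive.
    - split; [now exists du|split; [now exists dv|trivial]].
    - replace (Derive (fun t => u t) y) with du by (symmetry; now apply is_derive_unique).
      replace (Derive (fun t => v t) y) with dv by (symmetry; now apply is_derive_unique).
      ring. }
  specialize (S _ _ _ _ H1 H2).
  replace (- 2 * Im (l * Cconj (f (x, y)))) with
    (2 * (Re (f (x, y)) * - Im l + Im (f (x, y)) * Re l)); [exact S|].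
  unfold Re, Im; simpl; ring.
Qed.

(** * The difference operator: phases, derivative, exponentials *)

Lemma Cexp_Ci (t : R) : Cexp (Ci * RtoC t) = (cos t, sin t).
Proof.
  unfold Cexp; simpl.
  replace (0 * t - 1 * 0) with 0 by ring; replace (0 * 0 + 1 * t) with t by ring.
  rewrite exp_0; unfold Cmult; simpl; f_equal; ring.
Qed.

Lemma Cexp_opp_Ci (t : R) : Cexp (- (Ci * RtoC t)) = (cos t, - sin t).
Proof.
  replace (- (Ci * RtoC t))%C with (Ci * RtoC (- t))%C by (rewrite RtoC_opp; ring).
  now rewrite Cexp_Ci, cos_neg, sin_neg.
Qed.

Lemma sqmod_rotation (t : R) : sqmod (cos t, sin t) = 1.
Proof.
  pose proof (sin2_cos2 t) as H; unfold Rsqr in H; unfold sqmod; simpl; lra.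
Qed.

Lemma Cminus_div_eq0 (a b : C) : ((a - b) / (2 * Ci))%C = 0%C -> a = b.
Proof.
  intros H.
  assert (Hi : (2 * Ci)%C <> 0%C) by (intros E; injection E; intros; lra).
  replace a with ((a - b) / (2 * Ci) * (2 * Ci) + b)%C by (field; intros E; apply Hi; rewrite E; ring).
  rewrite H; ring.
Qed.

Lemma is_derive_Delta_op (theta h : R) (f : C -> C) (z l1 l2 : C) :
  is_derive (K := C_AbsRing) (V := C_NormedModule) f (z + Ci * RtoC h)%C l1 ->
  is_derive (K := C_AbsRing) (V := C_NormedModule) f (z - Ci * RtoC h)%C l2 ->
  is_derive (K := C_AbsRing) (V := C_NormedModule) (Delta_op theta h f) z
    ((Cexp (Ci * RtoC theta) * l1 - Cexp (- (Ci * RtoC theta)) * l2) / (2 * Ci))%C.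
Proof.
  intros H1 H2.
  assert (S : forall w l : C,
    is_derive (K := C_AbsRing) (V := C_NormedModule) f (z + w)%C l ->
    is_derive (K := C_AbsRing) (V := C_NormedModule) (fun x => f (x + w)%C) z l).
  { intros w l Hl.
    replace l with (scal (K := C_AbsRing) (V := C_NormedModule) (one : C_AbsRing) l)
      by apply scal_one.
    apply (is_derive_comp (K := C_AbsRing) (V := C_NormedModule) f (fun x => (x + w)%C)); auto.
    replace (one : C_AbsRing) with (plus (one : C_AbsRing) zero) by apply plus_zero_r.
    apply (is_derive_plus (K := C_AbsRing) (V := AbsRing_NormedModule C_AbsRing)
      (fun x => x) (fun _ => w)).
    - apply (is_derive_id (K := C_AbsRing)).
    - apply (is_derive_const (K := C_AbsRing) (V := AbsRing_NormedModule C_AbsRing)). }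
  assert (M : forall (k l : C) (g : C -> C),
    is_derive (K := C_AbsRing) (V := C_NormedModule) g z l ->
    is_derive (K := C_AbsRing) (V := C_NormedModule) (fun x => (k * g x)%C) z (k * l)%C).
  { intros k l g Hg.
    eapply filterdiff_ext_lin.
    - apply (filterdiff_comp' (K := C_AbsRing) (U := AbsRing_NormedModule C_AbsRing)
        (V := C_NormedModule) (W := C_NormedModule) g (scal (K := C_AbsRing) k) z _
        (scal (K := C_AbsRing) k) Hg).
      apply filterdiff_linear.
      apply (is_linear_scal_r (K := C_AbsRing) (V := C_NormedModule)); exact Cmult_comm.
    - intros y; unfold scal; simpl; unfold mult; simpl; ring. }
  replace ((Cexp (Ci * RtoC theta) * l1 - Cexp (- (Ci * RtoC theta)) * l2) / (2 * Ci))%C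
    with (/ (2 * Ci) * (Cexp (Ci * RtoC theta) * l1 - Cexp (- (Ci * RtoC theta)) * l2))%C
    by apply Cmult_comm.
  apply (is_derive_ext (K := C_AbsRing) (V := C_NormedModule)
    (fun x => / (2 * Ci) * (Cexp (Ci * RtoC theta) * f (x + Ci * RtoC h)
       - Cexp (- (Ci * RtoC theta)) * f (x + - (Ci * RtoC h))))%C).
  { intros t; apply Cmult_comm. }
  apply M.
  apply (is_derive_minus (K := C_AbsRing) (V := C_NormedModule)
    (fun x => Cexp (Ci * RtoC theta) * f (x + Ci * RtoC h))%C
    (fun x => Cexp (- (Ci * RtoC theta)) * f (x + - (Ci * RtoC h)))%C).
  - apply M, S, H1.
  - apply M, S, H2.
Qed.

(** The common phase cancels because [A * Cconj A = 1]; this makes the values at the two shifted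
    points comparable. *)
Lemma Im_rotate (A u v : C) : sqmod A = 1 ->
  Im (A * u * Cconj (A * v)) = Im (u * Cconj v).
Proof.
  destruct A as [a b], u as [p q], v as [r s]; unfold sqmod; simpl; intros H.
  transitivity ((a * (a * 1) + b * (b * 1)) * (p * - s + q * r)); [ring|rewrite H; ring].
Qed.

(** Shifting the argument only multiplies an exponential by a constant, so the image either vanishes
    identically or has no zeros. *)
Lemma Delta_op_exp (theta h c b : R) (f : C -> C) :
  (forall z, f z = (RtoC c * Cexp (RtoC b * z))%C) ->
  exists k : C, forall z, Delta_op theta h f z = (k * Cexp (RtoC b * z))%C.
Proof.
  intros Hf.
  exists ((Cexp (Ci * RtoC theta) * RtoC c * Cexp (RtoC b * (Ci * RtoC h))
    - Cexp (- (Ci * RtoC theta)) * RtoC c * Cexp (RtoC b * - (Ci * RtoC h))) / (2 * Ci))%C.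
  intros z; unfold Delta_op; rewrite !Hf; unfold Cminus.
  rewrite !Cmult_plus_distr_l, !Cexp_plus; unfold Cdiv; ring.
Qed.

Lemma Cexp_neq0 (z : C) : Cexp z <> 0%C.
Proof.
  rewrite <- sqmod_eq0, sqmod_Cexp; apply Rgt_not_eq, exp_pos.
Qed.

(** * Reality and simplicity of the zeros *)

Open Scope C_scope.

(* For [f] as below, [Delta_op theta h f] vanishes identically exactly when [f = 0], or when
   [f z = c exp (b z)] with [sin (theta + b h) = 0]; the zeros of the
   identically zero function are excluded. *)
Theorem theorem1p6 (h theta : R) (hh : h <> 0%R)
  (htheta : (0 <= theta < 2 * PI)%R)
  (f : C -> C) (hf : LaguerrePolya f)
  (hnz : exists w : C, Delta_op theta h f w <> 0) :
  forall z : C, Delta_op theta h f z = 0 ->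
    Im z = 0%R /\ simple_zero (Delta_op theta h f) z.
Proof.
  intros z Hz.
  destruct (LaguerrePolya_growth f hf) as [(c & b & Hf)|[Hnz Hg]].
  { exfalso; destruct hnz as [w Hw].
    destruct (Delta_op_exp theta h c b f Hf) as [k Hk].
    rewrite Hk in Hz, Hw.
    destruct (Ceq_dec k 0) as [->|Hk0]; [apply Hw; ring|].
    now apply (Cmult_neq_0 _ _ Hk0 (Cexp_neq0 (b * z))). }
  set (A := Cexp (Ci * RtoC theta)); set (A' := Cexp (- (Ci * RtoC theta))).
  assert (HA : sqmod A = 1%R) by (unfold A; rewrite Cexp_Ci; apply sqmod_rotation).
  assert (HA' : sqmod A' = 1%R).
  { unfold A'; rewrite Cexp_opp_Ci, <- cos_neg, <- sin_neg; apply sqmod_rotation. }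
  assert (Heq : A * f (z + Ci * RtoC h) = A' * f (z - Ci * RtoC h)).
  { now apply Cminus_div_eq0. }
  assert (Hsq : sqmod (f (z + Ci * RtoC h)) = sqmod (f (z - Ci * RtoC h))).
  { rewrite <- (Rmult_1_l (sqmod (f (z + _)))), <- HA, <- sqmod_mult, Heq,
      sqmod_mult, HA'; ring. }
  assert (Hshift : forall x y, (x, y) + Ci * RtoC h = (x, (y + h)%R)
                            /\ (x, y) - Ci * RtoC h = (x, (y - h)%R)).
  { intros x y; split; unfold Cminus, Cplus, Copp, Cmult, Ci, RtoC; simpl; f_equal; ring. }
  destruct z as [x y]; destruct (Hshift x y) as [Ep Em]; rewrite Ep, Em in *.
  destruct (Hg x) as (al & be & Hal & Hbe & HG).
  assert (Hy : y = 0%R).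
  { destruct (Req_dec y 0) as [|Hy]; auto; exfalso.
    assert (Hyh : (y * h <> 0)%R) by now apply Rmult_integral_contrapositive_currified.
    (* Since [(y + h) ^ 2 - (y - h) ^ 2 = 4 * y * h], this sign tells which shifted point is farther
       from the real axis; [f] would have to vanish there. *)
    destruct (Rlt_le_dec (y * h) 0) as [Hneg|Hpos].
    - apply (Hnz x (y - h)%R); [intros E; nra|].
      apply sqmod_eq0.
      apply (growth_unbalanced al be (fun t => sqmod (f (x, t))) (y + h) (y - h)); auto; nra.
    - apply (Hnz x (y + h)%R); [intros E; nra|].
      apply sqmod_eq0.
      apply (growth_unbalanced al be (fun t => sqmod (f (x, t))) (y - h) (y + h)); auto; nra. }
  subst y; split; [reflexivity|split; [assumption|]].
  rewrite Rplus_0_l in *; rewrite Rminus_0_l in *.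
  destruct hf as [[Hent _] _].
  destruct (Hent (x, h)) as [l1 Hl1]; destruct (Hent (x, (- h)%R)) as [l2 Hl2].
  exists ((A * l1 - A' * l2) / (2 * Ci)); split.
  { apply is_derive_Delta_op; [rewrite Ep|rewrite Em]; assumption. }
  intros H0.
  apply Cminus_div_eq0 in H0.
  (* A vanishing derivative gives [A * l1 = A' * l2], alongside [A * f (x, h) = A' * f (x, - h)];
     the phases drop out of the products. *)
  assert (Him : Im (l1 * Cconj (f (x, h))) = Im (l2 * Cconj (f (x, (- h)%R)))).
  { rewrite <- (Im_rotate A _ _ HA), H0, Heq; now apply Im_rotate. }
  assert (Hpos : forall t, t <> 0%R -> (0 < sqmod (f (x, t)))%R).
  { intros t Ht; now apply sqmod_gt0, Hnz. }
  assert (hh' : (- h <> 0)%R) by lra.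
  (* By [Him] the two vertical derivatives are equal, yet their products with [h] and with [- h] are
     both positive. *)
  pose proof (growth_derive al be _ h _ Hal Hbe HG hh (Hpos h hh)
    (is_derive_sqmod_vertical f x h l1 Hl1)) as D1.
  pose proof (growth_derive al be _ (- h) _ Hal Hbe HG hh' (Hpos _ hh')
    (is_derive_sqmod_vertical f x (- h) l2 Hl2)) as D2.
  rewrite Him in D1; lra.
Qed.
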